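(* Assume that the function $\theta\mapsto\mathcal L_n(\theta)$ is convex and that the training and aggregation samples are independent. Conditionally on the training sample (so that the candidate estimators $\tilde\theta_{n,k}$ are treated as fixed), assume that there exist positive absolute constants $\xi_1,\xi_2,\xi_3$ such that, for every sufficiently large $n$ and every $\theta\in\Theta_n$, $$P_\star^{(n)}\left[\exp(-\lambda\{\ell_n(\theta)-\ell_n^\star\})\right]\le \exp(-\xi_1\mathcal L_n(\theta)),\qquad P_\star^{(n)}\left[\exp(\lambda\xi_2\{\ell_n(\theta)-\ell_n^\star\})\right]\le \exp(\xi_3\mathcal L_n(\theta)).$$ Let $\tilde\tau_*>0$ and $C_8>0$ be absolute constants such that, conditionally on the training sample, for every sufficiently large $n$, $$P_\star^{(n)}\left(\tilde m_n\ge\min\{\tilde k_n^\dagger(\tilde\tau_* )+1,M_n\}\right)\ge1-\tilde\eta_n,\qquad\tilde\eta_n:=\tilde k_n^\dagger(\tilde\tau_* )\exp\left(-C_8\,\mathcal L_n\left(\tilde\theta_{n,\tilde k_n^\dagger(\tilde\tau_* )}\right)\right)$$ (such constants exist whenever the training and aggregation samples are independent and, for some positive absolute constants $\xi_1,\xi_2,\xi_3$, the two exponential-moment inequalities $P_\star^{(n)}[\exp(-\lambda\{\ell_n(\theta)-\ell_n^\star\})]\le \exp(-\xi_1\mathcal L_n(\theta))$ and $P_\star^{(n)}[\exp(\lambda\xi_2\{\ell_n(\theta)-\ell_n^\star\})]\le \exp(\xi_3\mathcal L_n(\theta))$ hold for every sufficiently large $n$ and every $\theta\in\Theta_n$). Then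 there exists an absolute constant $C_9>0$ such that, conditionally on the training sample, for every sufficiently large $n$, $$P_\star^{(n)}\left(\mathcal L_n(\tilde\theta_n^{\mathrm{ESA}})\le C_9\left\{\min_{k\in[M_n],\,k\le\tilde k_n^\dagger(\tilde\tau_* )+1}\mathcal L_n(\tilde\theta_{n,k})+\log(M_nn)\right\}\right)\ge1-\tilde\eta_n-n^{-1}.$$
   Context: Setup. The full sample is split into a training sample and an aggregation sample. $X^{(n)}$, with values in a measurable space $\mathcal X_n$, denotes the aggregation sample and $P_\star^{(n)}$ its true distribution; $P_\star^{(n)}[\cdot]$ denotes expectation and $P_\star^{(n)}(\cdot)$ probability with respect to the aggregation sample. $\mathcal P(\cdot)$ is the set of probability measures on a space; $[m]=\{1,\dots,m\}$. The models are parameter spaces $\Theta_{n,1},\dots,\Theta_{n,M_n}$, each $\theta$ indexing a distribution $P_\theta^{(n)}\in\mathcal P(\mathcal X_n)$, and they are nested: for each $k<M_n$ there is an embedding $T:\Theta_{n,k}\to\Theta_{n,k+1}$ with $P^{(n)}_\theta=P^{(n)}_{T(\theta)}$ for all $\theta\in\Theta_{n,k}$. Put $\Theta_n=\bigcup_{k=1}^{M_n}\Theta_{n,k}$. A loss $\ell_n:\mathcal P(\mathcal X_n)\times\mathcal X_n\to[0,\infty)$ is given; write $\ell_n(\theta)=\ell_n(P_\theta^{(n)},X^{(n)})$ and $\ell_n^\star=\ell_n(P_\star^{(n)},X^{(n)})$ (losses evaluated on the aggregation sample). The excess risk is $\mathcal L_n(\theta)=P_\star^{(n)}[\ell_n(\theta)-\ell_n^\star]$.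 Parameters are regarded as elements of a common real vector space so that weighted averages of parameters make sense, with $\mathcal L_n$ defined (and convex) on a convex set containing $\Theta_n$. $\lambda>0$ and $\alpha>0$ are fixed constants. ''Absolute constant'' means a constant not depending on $n$ or $k$. For each $k\in[M_n]$, $\tilde\theta_{n,k}\in\Theta_{n,k}$ is a candidate estimator (not necessarily an empirical risk minimizer) computed from the training sample only. Stopping index: $\tilde m_n=\inf\{k\in[M_n]\setminus\{1\}:\ell_n(\tilde\theta_{n,k-1})<\ell_n(\tilde\theta_{n,k})\}\wedge M_n$ (with $\inf\emptyset=\infty$). SS-ESA estimator: $\tilde\theta_n^{\mathrm{ESA}}=\sum_{k=1}^{\tilde m_n}\tilde\omega_{n,k}\tilde\theta_{n,k}$ with $\tilde\omega_{n,k}=\exp(-\alpha\ell_n(\tilde\theta_{n,k}))/\sum_{k'=1}^{\tilde m_n}\exp(-\alpha\ell_n(\tilde\theta_{n,k'}))$. Near-optimal index: for $\tau>0$, $\tilde k_n^\dagger(\tau)$ is the smallest $k\in[M_n-1]$ with $\mathcal L_n(\tilde\theta_{n,k})\le(1+\tau)\mathcal L_n(\tilde\theta_{n,k+1})$, and $\tilde k_n^\dagger(\tau)=M_n$ if there is no such $k$. *)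

(* Defs.v *)
From HB Require Import structures.
From mathcomp Require Import all_boot all_order all_algebra.
From mathcomp Require Import all_classical all_reals all_analysis.

Set Implicit Arguments.
Unset Strict Implicit.
Unset Printing Implicit Defensive.

Import Order.TTheory GRing.Theory Num.Theory.
Import numFieldNormedType.Exports.

Local Open Scope classical_set_scope.
Local Open Scope ring_scope.

(** The data attached to one sample size [n].  Models and candidate estimators
    are indexed by [k : nat] with [1 <= k <= nmodels]; values at other indices
    are irrelevant.  All parameters live in the real vector space [Par]. *)
Record experiment (R : realType) := Experiment {
  base_disp : measure_display;
  base : measurableType base_disp;
  base_prob : probability base R;
  train_disp : measure_display;
  Train : measurableType train_disp;
  obs_disp : measure_display;
  Obs : measurableType obs_disp;
  train_sample : {mfun base >-> Train};
  aggr_sample : {mfun base >-> Obs};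
  nmodels : nat;
  Par : lmodType R;
  model : nat -> set Par;
  (* convex set of parameters on which the excess risk is defined *)
  cvx_dom : set Par;
  (* [Plaw theta] is P_theta; only its values on [cvx_dom] matter *)
  Plaw : Par -> probability Obs R;
  loss : probability Obs R -> Obs -> R;
  (* a candidate estimator is a function of the training data alone *)
  cand : nat -> Train -> Par;
  nmodels_gt0 : (0 < nmodels)%N;
  nested : forall k, (1 <= k < nmodels)%N ->
    exists T : {injfun model k >-> model k.+1},
      forall theta, model k theta -> Plaw theta = Plaw (T theta);
  cvx_dom_convex : convex_set cvx_dom;
  model_sub : forall k, (1 <= k <= nmodels)%N -> model k `<=` cvx_dom;
  loss_ge0 : forall P x, 0 <= loss P x;
  (* the excess risk is a well-defined real number on [cvx_dom] *)
  excess_integrable : forall theta, cvx_dom theta ->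
    (distribution base_prob aggr_sample).-integrable setT
      (fun x => (loss (Plaw theta) x
                 - loss (distribution base_prob aggr_sample) x)%:E);
  cand_in : forall k d, (1 <= k <= nmodels)%N -> model k (cand k d)
}.

Section experiment_defs.
Context {R : realType} (E : experiment R).

Definition train_law : probability (Train E) R :=
  distribution (base_prob E) (train_sample E).

Definition Pstar : probability (Obs E) R :=
  distribution (base_prob E) (aggr_sample E).

Definition independent_samples : Prop :=
  forall (A : set (Train E)) (B : set (Obs E)), measurable A -> measurable B ->
  base_prob E (train_sample E @^-1` A `&` aggr_sample E @^-1` B) =
  (base_prob E (train_sample E @^-1` A) * base_prob E (aggr_sample E @^-1` B))%E.

Definition all_params : set (Par E) :=
  \bigcup_(k in [set k | (1 <= k <= nmodels E)%N]) model k.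

Definition excess_loss (theta : Par E) (x : Obs E) : R :=
  loss (Plaw theta) x - loss Pstar x.

Definition excess_risk (theta : Par E) : R :=
  fine 'E_Pstar[excess_loss theta].

(** Under independence, conditioning on the training sample amounts to fixing
    its value [d] and letting the aggregation sample [x] have law [Pstar]: the
    constant kernel [Pstar] is a regular conditional distribution of the
    aggregation sample given the training sample.  "Conditionally on the
    training sample, [p d]" is thus [{ae train_law, forall d, p d}], where all
    probabilities in [p d] are [Pstar]-probabilities with [d] fixed. *)

Definition cand_loss (k : nat) (d : Train E) (x : Obs E) : R :=
  loss (Plaw (cand k d)) x.

Definition cand_risk (k : nat) (d : Train E) : R := excess_risk (cand k d).

(* starting the minimum at [nmodels] is the truncation by M_n, and gives M_n
   when no index qualifies; likewise for [near_opt_index] *)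
Definition stop_index (d : Train E) (x : Obs E) : nat :=
  \big[minn/nmodels E]_(2 <= k < (nmodels E).+1
                       | cand_loss k.-1 d x < cand_loss k d x) k.

Definition near_opt_index (tau : R) (d : Train E) : nat :=
  \big[minn/nmodels E]_(1 <= k < nmodels E
                       | cand_risk k d <= (1 + tau) * cand_risk k.+1 d) k.

Definition esa_weight (alpha : R) (k : nat) (d : Train E) (x : Obs E) : R :=
  expR (- alpha * cand_loss k d x) /
  \sum_(1 <= j < (stop_index d x).+1) expR (- alpha * cand_loss j d x).

Definition esa (alpha : R) (d : Train E) (x : Obs E) : Par E :=
  \sum_(1 <= k < (stop_index d x).+1) esa_weight alpha k d x *: cand k d.

(* the index 1 always belongs to the range, so the default value is harmless *)
Definition oracle_risk (tau : R) (d : Train E) : R :=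
  \big[Num.min/cand_risk 1 d]_(1 <= k < (nmodels E).+1
                              | (k <= near_opt_index tau d + 1)%N) cand_risk k d.

Definition early_stop_bound (tau C8 : R) (d : Train E) : R :=
  (near_opt_index tau d)%:R *
  expR (- C8 * cand_risk (near_opt_index tau d) d).

Definition exp_moment_bounds (lambda xi1 xi2 xi3 : R) : Prop :=
  forall theta, all_params theta ->
  ('E_Pstar[fun x => expR (- lambda * excess_loss theta x)] <=
     (expR (- xi1 * excess_risk theta))%:E)%E /\
  ('E_Pstar[fun x => expR (lambda * xi2 * excess_loss theta x)] <=
     (expR (xi3 * excess_risk theta))%:E)%E.

Definition stop_late (tau : R) (d : Train E) : set (Obs E) :=
  [set x | (minn (near_opt_index tau d + 1) (nmodels E) <= stop_index d x)%N].

End experiment_defs.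

Arguments cvx_dom {R} _ _ : rename.
Arguments excess_risk {R} E theta.

(** The constants [tau] and [C8] do not depend on [n], [k] or the training
    data. *)
Definition stop_late_whp (R : realType) (E : nat -> experiment R)
    (tau C8 : R) : Prop :=
  \forall n \near \oo, {ae train_law (E n), forall d,
    ((1 - early_stop_bound tau C8 d)%:E <= Pstar (E n) (stop_late tau d))%E}.

(* Main.v *)
Require Import Defs.
From HB Require Import structures.
From mathcomp Require Import all_boot all_order all_algebra.
From mathcomp Require Import all_classical all_reals all_analysis.
From mathcomp Require Import ring lra measurable_realfun.

Import Order.TTheory GRing.Theory Num.Theory.
Import numFieldNormedType.Exports.

(** Write [D k] for the excess loss and [L k] for the excess risk of the [k]-th
    candidate.  Markov's inequality turns the two moment bounds into the tails
    [lambda * D k >= xi1 * L k - t] and [lambda * xi2 * D k <= xi3 * L k + t],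
    each failing with probability at most [exp (- t)].

    Late stopping: before the near-optimal index [K] the risk drops by a factor
    [1 + tau] at each step, so for large [tau] the two tails cut at the same
    level make [D k < D (k + 1)] unlikely, and a union bound over [k < K]
    applies.  The factor 2 it costs is absorbed by halving the exponent, as the
    claim is trivial unless [K * exp (- C8 * L K) < 1].

    Oracle inequality: with [t] about [ln (M * n)] all the tails needed hold
    with probability at least [1 - 1 / n].  On that event Jensen bounds the risk
    of the aggregate by the weighted mean of the [L k], the lower tails replace
    [L k] by [D k], the exponential weights bring the mean of the [D k] within
    [(ln M + 1) / alpha] of the oracle's one (which is a summand because the
    stopping is late), and the upper tail returns to the oracle risk.  That risk
    is positive unless [L K <= 0], when the probability bound is trivial.

    A measure is unspecified on non-measurable sets, so the event about the risk
    of the aggregate must be shown measurable; convexity alone gives this. *)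

Set Implicit Arguments.
Unset Strict Implicit.

Local Open Scope classical_set_scope.
Local Open Scope ring_scope.

(** * Barycenters and perspectives of convex functions *)

Definition barycenter {R : fieldType} {V : lmodType R} {I : Type} (r : seq I)
    (w : I -> R) (v : I -> V) : V :=
  (\sum_(i <- r) w i)^-1 *: \sum_(i <- r) w i *: v i.

Section ConvexFunction.
Context {R : realType} {V : lmodType R} {D : set V} {f : V -> R}.
Hypotheses (D_convex : convex_set D) (f_convex : convex_function D f).

Lemma convex_set_wavg (a b : R) (x y : V) : 0 < a -> 0 < b -> D x -> D y ->
  D ((a + b)^-1 *: (a *: x + b *: y)).
Proof.
move=> a0 b0 Dx Dy; have ab0 : 0 < a + b by rewrite addr_gt0.
have p0 : 0 <= a / (a + b) by rewrite divr_ge0// ltW.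
have p1 : a / (a + b) <= 1 by rewrite ler_pdivrMr// mul1r lerDl ltW.
have := @D_convex x y (Itv01 p0 p1); rewrite !inE => /(_ Dx Dy).
congr (D _); rewrite /conv/= /unstable.onem scalerDr !scalerA (mulrC a).
by congr (_ + _ *: _); field; lra.
Qed.

Lemma convex_function_wavg (a b : R) (x y : V) :
  0 < a -> 0 < b -> D x -> D y ->
  (a + b) * f ((a + b)^-1 *: (a *: x + b *: y)) <= a * f x + b * f y.
Proof.
move=> a0 b0 Dx Dy; have ab0 : 0 < a + b by rewrite addr_gt0.
have : 0 <= a / (a + b) by rewrite divr_ge0// ltW.
have : a / (a + b) <= 1 by rewrite ler_pdivrMr// mul1r lerDl ltW.
have -> : (a + b)^-1 *: (a *: x + b *: y) =
    (a / (a + b)) *: x + (1 - a / (a + b)) *: y.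
  rewrite scalerDr !scalerA (mulrC a); congr (_ + _ *: _).
  by field; lra.
have -> : a * f x + b * f y =
    (a + b) * (a / (a + b) * f x + (1 - a / (a + b)) * f y) by field; lra.
rewrite ler_pM2l//; move: (a / (a + b)) => p p1 p0.
by have := @f_convex (Itv01 p0 p1) x y; rewrite !inE => /(_ Dx Dy).
Qed.

Lemma sum_gt0 {I : Type} (r : seq I) (w : I -> R) :
  (0 < size r)%N -> (forall i, 0 < w i) -> 0 < \sum_(i <- r) w i.
Proof.
case: r => // i r _ w0; rewrite big_cons ltr_pwDl//.
by rewrite sumr_ge0// => j _; rewrite ltW.
Qed.

Lemma barycenter_cons {I : Type} i (r : seq I) (w : I -> R) (v : I -> V) :
  (0 < size r)%N -> (forall j, 0 < w j) ->
  barycenter (i :: r) w v = (w i + \sum_(j <- r) w j)^-1 *: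
    (w i *: v i + (\sum_(j <- r) w j) *: barycenter r w v).
Proof.
move=> r0 w0; rewrite /barycenter !big_cons scalerA divff ?scale1r//.
by rewrite gt_eqF// sum_gt0.
Qed.

Lemma barycenter_in {I : Type} (r : seq I) (w : I -> R) (v : I -> V) :
  (0 < size r)%N -> (forall i, 0 < w i) -> (forall i, D (v i)) ->
  D (barycenter r w v).
Proof.
move=> + w0 Dv; elim: r => // i [|j r] IHr _.
  by rewrite /barycenter !big_seq1 scalerA mulVf ?scale1r// gt_eqF.
by rewrite barycenter_cons//; apply: convex_set_wavg => //;
  [exact: sum_gt0|exact: IHr].
Qed.

Lemma jensen {I : Type} (r : seq I) (w : I -> R) (v : I -> V) :
  (0 < size r)%N -> (forall i, 0 < w i) -> (forall i, D (v i)) ->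
  (\sum_(i <- r) w i) * f (barycenter r w v) <= \sum_(i <- r) w i * f (v i).
Proof.
move=> + w0 Dv; elim: r => // i [|j r] IHr _.
  by rewrite /barycenter !big_seq1 scalerA mulVf ?scale1r// gt_eqF.
rewrite barycenter_cons// [in leRHS]big_cons.
have -> : \sum_(k <- [:: i, j & r]) w k = w i + \sum_(k <- j :: r) w k.
  by rewrite big_cons.
apply: (le_trans (convex_function_wavg _ _ _ _)) => //=.
- exact: sum_gt0.
- exact: barycenter_in.
- by rewrite lerD2l IHr.
Qed.

(** The barycenter for [p \+ q] is the weighted average of those for [p] and for [q]; two-point
    convexity splits them, and Jensen spreads the [q] part over the points [v i]. *)
Lemma perspective_subadd {I : Type} (r : seq I) (p q : I -> R) (v : I -> V) :
  (0 < size r)%N -> (forall i, 0 < p i) -> (forall i, 0 < q i) ->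
  (forall i, D (v i)) ->
  (\sum_(i <- r) (p i + q i)) * f (barycenter r (p \+ q) v) <=
  (\sum_(i <- r) p i) * f (barycenter r p v) + \sum_(i <- r) q i * f (v i).
Proof.
move=> r0 p0 q0 Dv; have Sp := sum_gt0 r0 p0; have Sq := sum_gt0 r0 q0.
have -> : barycenter r (p \+ q) v =
    (\sum_(i <- r) p i + \sum_(i <- r) q i)^-1 *:
    ((\sum_(i <- r) p i) *: barycenter r p v +
     (\sum_(i <- r) q i) *: barycenter r q v).
  rewrite /barycenter !scalerA !divff ?gt_eqF// !scale1r -!big_split/=.
  by under [X in _ *: X]eq_bigr do rewrite scalerDl.
rewrite big_split/=.
apply: (le_trans (convex_function_wavg _ _ _ _)) => //=.
- exact: barycenter_in.
- exact: barycenter_in.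
- by rewrite lerD2l jensen.
Qed.

Lemma barycenter_scale {I : Type} (r : seq I) (w : I -> R) (v : I -> V) c :
  c != 0 -> barycenter r (fun i => c * w i) v = barycenter r w v.
Proof.
move=> c0; rewrite /barycenter -mulr_sumr.
under [X in _ *: X]eq_bigr do rewrite -scalerA.
by rewrite -scaler_sumr scalerA invfM mulrAC mulVf// mul1r.
Qed.

(* The perspective [w |-> (sum w) * f (barycenter w)] is homogeneous and
   subadditive, so rationals [q] between [(1 - s) * a] and [a], with [s] small,
   witness the strict inequality; no continuity of [f] is needed. *)
Lemma perspective_lt_rat {I : finType} (a : I -> R) (v : I -> V) (c : R) :
  (0 < #|I|)%N -> (forall i, 0 < a i) -> (forall i, D (v i)) ->
  f (barycenter (index_enum I) a v) < c <->
  exists q : {ffun I -> rat}, [/\ (forall i, 0 < ratr (q i) :> R),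
    (forall i, ratr (q i) < a i) &
    (\sum_i ratr (q i)) * f (barycenter (index_enum I) (ratr \o q) v) +
    \sum_i (a i - ratr (q i)) * f (v i) < c * \sum_i a i].
Proof.
move=> I0 a0 Dv.
have r0 : (0 < size (index_enum I))%N by move: I0; rewrite cardT enumT.
have S0 := sum_gt0 r0 a0; split => [fc|[q [q0 qa]]]; last first.
  rewrite [c * _]mulrC -[in X in _ -> X](ltr_pM2l S0).
  apply: le_lt_trans.
  have d0 i : 0 < a i - ratr (q i) by rewrite subr_gt0.
  have := perspective_subadd r0 q0 d0 Dv.
  rewrite (_ : _ \+ _ = a)//; last by apply/funext => i /=; rewrite addrC subrK.
  by under eq_bigr do rewrite addrC subrK.
set g := (\sum_i a i) * f (barycenter (index_enum I) a v) - c * \sum_i a i.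
have g0 : g < 0 by rewrite /g mulrC -mulrBl nmulr_rlt0// subr_lt0.
pose F := \sum_i a i * f (v i).
have [s /andP[s0 s1] Hs] : exists2 s : R, 0 < s < 1 &
    (1 - s) * ((\sum_i a i) * f (barycenter (index_enum I) a v)) + s * F
    < c * \sum_i a i.
  have K0 : 0 < - g + `|F - c * \sum_i a i - g| + 1.
    by rewrite ltr_wpDl// addr_ge0// oppr_ge0 ltW.
  (* Along the segment from [g] to [F - c * \sum_i a i] the value at [s] is [g] plus [s] times the
     difference of the endpoints. The denominator exceeds both [- g] and that difference, so [s < 1]
     and the value stays negative. *)
  exists (- g / (- g + `|F - c * \sum_i a i - g| + 1)).
    rewrite divr_gt0 ?oppr_gt0//= ltr_pdivrMr// mul1r.
    by rewrite -addrA ltrDl ltr_wpDl.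
  rewrite -subr_lt0.
  set K := _ + 1 in K0 *.
  have -> : forall u S, (1 - - g / K) * u + - g / K * F - S =
     (u - S) + - g / K * ((F - S) - (u - S)) by move=> u S; ring.
  rewrite -/g addrC -ltrBrDr sub0r mulrAC ltr_pdivrMr//.
  rewrite ltr_pM2l ?oppr_gt0// /K.
  by apply: (le_lt_trans (ler_norm _)); move: `|_| g0 => u; lra.
have lt_a i : (1 - s) * a i < a i by rewrite gtr_pMl//; lra.
have H i : exists q : rat, (1 - s) * a i < ratr q < a i.
  by have [q] := rat_in_itvoo (lt_a i); rewrite in_itv/=; exists q.
pose q := [ffun i => xchoose (H i)].
have qP i : (1 - s) * a i < ratr (q i) < a i.
  by rewrite ffunE; exact: (xchooseP (H i)).
have s1' : 0 < 1 - s by lra.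
exists q; split => [i|i|].
- have /andP[+ _] := qP i; apply: lt_trans; by rewrite mulr_gt0.
- by have /andP[] := qP i.
apply: le_lt_trans Hs.
(* Subadditivity is applied to [q] as [(1 - s) * a] plus a positive remainder. That remainder and
   [a - q] add up to [s * a], which produces the term [s * F]. *)
have p0 i : 0 < (1 - s) * a i by exact: mulr_gt0.
have d0 i : 0 < ratr (q i) - (1 - s) * a i.
  by rewrite subr_gt0; have /andP[] := qP i.
have := perspective_subadd r0 p0 d0 Dv.
rewrite (_ : _ \+ _ = ratr \o q)//; last first.
  by apply/funext => i /=; rewrite addrC subrK.
rewrite barycenter_scale ?gt_eqF// -mulr_sumr.
under eq_bigr do rewrite addrC subrK.
move=> H1; rewrite -lerBrDr; apply: (le_trans H1).
rewrite -addrA mulrA lerD2l /F mulr_sumr -sumrB ler_sum// => i _.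
by rewrite le_eqVlt; apply/orP; left; apply/eqP => /=; ring.
Qed.
(** For each rational [q] the condition of [perspective_lt_rat] evaluates [f] at points that do not
    depend on [x], so it is a finite system of measurable inequalities. Strict sublevel sets are
    then countable unions of such sets. *)
Lemma measurable_convex_barycenter {d} {T : measurableType d} {I : finType}
    (a : I -> T -> R) (v : I -> V) :
  (0 < #|I|)%N -> (forall i x, 0 < a i x) ->
  (forall i, measurable_fun setT (a i)) -> (forall i, D (v i)) ->
  measurable_fun setT (fun x => f (barycenter (index_enum I) (a^~ x) v)).
Proof.
move=> I0 a0 ma Dv.
apply: (measurability (@RGenInftyO.G R)).
  exact: RGenInftyO.measurableE.
move=> _ [_ [c ->] <-]; rewrite setTI.
have msum (u : I -> R -> R) : (forall i, measurable_fun setT (u i)) ->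
    measurable_fun setT (fun x => \sum_i u i (a i x)).
  move=> mu; apply: measurable_sum => i; exact: measurableT_comp.
rewrite (_ : _ @^-1` _ = \bigcup_(q : {ffun I -> rat})
   ([set x | [forall i, (0 < ratr (q i) :> R) && (ratr (q i) < a i x)]] `&`
   [set x | (\sum_i ratr (q i)) *
      f (barycenter (index_enum I) (ratr \o q) v) +
      \sum_i (a i x - ratr (q i)) * f (v i) < c * \sum_i a i x])); last first.
  apply/seteqP; split => x /=; rewrite in_itv/=.
    move=> /(perspective_lt_rat c I0 (a0^~ x) Dv)[q [q0 qa H]].
    exists q => //; split => //=; apply/forallP => i; apply/andP; split => //.
  move=> [q _ [/= /forallP qP H]].
  apply/(perspective_lt_rat c I0 (a0^~ x) Dv); exists q; split => // i.
  - by have /andP[] := qP i.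
  - by have /andP[] := qP i.
apply: countable_bigcupT_measurable => // q; apply: measurableI.
  rewrite (_ : [set _ | _] = \bigcap_(i in [set: I])
      [set x | (0 < ratr (q i) :> R) && (ratr (q i) < a i x)]); last first.
    apply/seteqP; split => x /=; first by move=> /forallP H i _; exact: H.
    by move=> H; apply/forallP => i; exact: H.
  apply: fin_bigcap_measurable => // i _.
  rewrite (_ : [set _ | _] = [set x | 0 < ratr (q i) :> R] `&`
      [set x | ratr (q i) < a i x]); last first.
    by apply/seteqP; split => x /=; [move/andP|case=> -> ->].
  by apply: measurableI; rewrite -[X in measurable X]setTI;
    apply: measurable_fun_ltr.
rewrite -[X in measurable X]setTI; apply: measurable_fun_ltr => //.
  apply: measurable_funD => //.
  apply: (msum (fun i t => (t - ratr (q i)) * f (v i))) => i.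
  by apply: measurable_funM => //; apply: measurable_funB.
by apply: measurable_funM => //; exact: (msum (fun=> id)).
Qed.
End ConvexFunction.

(** * Truncated minima of indices and the Chernoff bound *)

Lemma bigminn_cases (N : nat) (r : seq nat) (P : pred nat) :
  let b := (\big[minn/N]_(k <- r | P k) k)%N in b = N \/ (b \in r) && P b.
Proof.
elim: r => [|k r IHr] /=; first by rewrite big_nil; left.
rewrite big_cons; case: ifP => Pk; last first.
  by case: IHr => [->|/andP[br Pb]]; [left|right; rewrite in_cons br Pb orbT].
rewrite /minn; case: ifP => _; first by right; rewrite mem_head.
by case: IHr => [->|/andP[br Pb]]; [left|right; rewrite in_cons br Pb orbT].
Qed.

Lemma leq_bigminn (N j : nat) (r : seq nat) (P : pred nat) :
  (j <= \big[minn/N]_(k <- r | P k) k)%N =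
  (j <= N)%N && all (fun k => P k ==> (j <= k)%N) r.
Proof.
elim: r => [|k r IHr] /=; first by rewrite big_nil andbT.
rewrite big_cons; case: ifP => Pk; last by rewrite IHr.
by rewrite leq_min IHr /=; case: (j <= k)%N; rewrite ?andbF.
Qed.

(** Chernoff's bound at parameter 1, any scaling being already inside [Y]: the moment bound
    contributes the centre [b] and [t] is the slack beyond it. *)
Lemma chernoff_expectation {d} {T : measurableType d} {R : realType}
    (P : probability T R) (Y : T -> R) (b t : R) : measurable_fun setT Y ->
  ('E_P[fun x => expR (Y x)] <= (expR b)%:E)%E ->
  (P [set x | (b + t <= Y x)%R] <= (expR (- t))%:E)%E.
Proof.
move=> mY bY.
pose Y' : {RV P >-> R} := mfun_Sub (mem_set mY).
have := chernoff Y' (b + t) ltr01.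
rewrite mul1r => /le_trans; apply.
have -> : expR (- t) = expR b * expR (- (b + t)) :> R.
  by rewrite -expRD; congr expR; lra.
rewrite EFinM lee_wpmul2r ?lee_fin ?expR_ge0//.
move: bY; rewrite /mmt_gen_fun; congr (_ <= _)%E.
by congr expectation; apply/funext => x /=; rewrite mulr1.
Qed.

(** * Stopping and near-optimal indices, tails of the excess losses *)

Section Experiment.
Context {R : realType} {E : experiment R}.
Implicit Types (k : nat) (d : Train E) (x : Obs E) (tau : R).

Lemma cand_all_params k d : (1 <= k <= nmodels E)%N -> all_params (cand k d).
Proof. by move=> k1; exists k => //; exact: cand_in. Qed.

Lemma all_params_cvx_dom : @all_params R E `<=` cvx_dom E.
Proof. by move=> theta [k k1]; exact: model_sub. Qed.

Lemma cand_cvx_dom k d : (1 <= k <= nmodels E)%N -> cvx_dom E (cand k d).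
Proof. by move=> k1; apply/all_params_cvx_dom/cand_all_params. Qed.

Lemma measurable_excess_loss (theta : Par E) :
  cvx_dom E theta -> measurable_fun setT (excess_loss theta).
Proof.
move=> Dtheta; apply/measurable_EFinP.
exact: (measurable_int _ (excess_integrable Dtheta)).
Qed.

(** The loss of the true law cancels. Comparisons thus pass to excess losses, whose measurability
    follows from [excess_integrable] and whose tails are controlled. *)
Lemma cand_lossB i j d x : cand_loss i d x - cand_loss j d x =
  excess_loss (cand i d) x - excess_loss (cand j d) x.
Proof. by rewrite /cand_loss /excess_loss; ring. Qed.

Lemma cand_loss_lt i j d x : (cand_loss i d x < cand_loss j d x) =
  (excess_loss (cand i d) x < excess_loss (cand j d) x).
Proof. by rewrite -subr_lt0 cand_lossB subr_lt0. Qed.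

Lemma near_opt_index_gt0 tau d : (0 < near_opt_index tau d)%N.
Proof.
rewrite /near_opt_index leq_bigminn nmodels_gt0/=; apply/allP => k.
by rewrite mem_index_iota => /andP[-> _]; rewrite implybT.
Qed.

Lemma near_opt_index_le tau d : (near_opt_index tau d <= nmodels E)%N.
Proof.
have : (near_opt_index tau d <= near_opt_index tau d)%N by [].
by rewrite [X in (_ <= X)%N]/near_opt_index leq_bigminn => /andP[].
Qed.

Lemma lt_near_opt_index tau d k : (0 < k < near_opt_index tau d)%N ->
  (1 + tau) * cand_risk k.+1 d < cand_risk k d.
Proof.
move=> /andP[k0 kK]; rewrite ltNge; apply/negP => Lk.
move: kK; rewrite ltnNge => /negP; apply.
have : (near_opt_index tau d <= near_opt_index tau d)%N by [].
rewrite [X in (_ <= X)%N]/near_opt_index leq_bigminn => /andP[KM /allP].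
have [kM|Mk _] := ltnP k (nmodels E); last exact: leq_trans Mk.
by move=> /(_ k); rewrite mem_index_iota k0 kM Lk => /(_ isT).
Qed.

Lemma near_opt_indexP tau d : (near_opt_index tau d < nmodels E)%N ->
  cand_risk (near_opt_index tau d) d <=
  (1 + tau) * cand_risk (near_opt_index tau d).+1 d.
Proof.
rewrite /near_opt_index.
have [->|/andP[_ H _]] := bigminn_cases (nmodels E) (index_iota 1 (nmodels E))
  (fun k => cand_risk k d <= (1 + tau) * cand_risk k.+1 d); last exact: H.
by rewrite ltnn.
Qed.

(** An increase of the loss at [j] itself is allowed, since stopping there still gives the index
    [j]; only increases strictly before [j] are excluded. *)
Lemma leq_stop_index j d x : (j <= stop_index d x)%N =
  (j <= nmodels E)%N &&
  all (fun k => (k < j)%N ==>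
    (excess_loss (cand k d) x <= excess_loss (cand k.-1 d) x))
  (index_iota 2 (nmodels E).+1).
Proof.
rewrite /stop_index leq_bigminn; congr (_ && _); apply: eq_all => k.
by rewrite cand_loss_lt leNgt ltnNge implybNN.
Qed.

Lemma stop_index_gt0 d x : (0 < stop_index d x)%N.
Proof.
rewrite leq_stop_index nmodels_gt0; apply/allP.
by case=> [|k] //; rewrite mem_index_iota.
Qed.

Lemma stop_index_le d x : (stop_index d x <= nmodels E)%N.
Proof.
have : (stop_index d x <= stop_index d x)%N by [].
by rewrite leq_stop_index => /andP[].
Qed.

Lemma measurable_leq_stop_index j d :
  measurable [set x | (j <= stop_index d x)%N].
Proof.
have [jM|jM] := leqP j (nmodels E); last first.
  rewrite (_ : [set _ | _] = set0)//; apply/seteqP; split => x //=.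
  by rewrite leqNgt (leq_ltn_trans (stop_index_le d x) jM).
rewrite (_ : [set _ | _] = \bigcap_(k in [set k | (2 <= k < j)%N])
   [set x | excess_loss (cand k d) x <= excess_loss (cand k.-1 d) x]).
  apply: bigcap_measurableType => k /= /andP[k2 kj].
  rewrite -[X in measurable X]setTI; apply: measurable_fun_ler => //;
    apply/measurable_excess_loss/cand_cvx_dom.
    by rewrite (ltnW k2) (leq_trans (ltnW kj)).
  case: k k2 kj => // k k2 kj; apply/andP; split => //=.
  by rewrite (leq_trans _ jM)// ltnW// ltnW.
apply/seteqP; split => x /=.
  rewrite leq_stop_index => /andP[_ /allP H] k /= /andP[k2 kj].
  have := H k; rewrite mem_index_iota k2 ltnS (leq_trans (ltnW kj) jM) kj.
  exact.
move=> H; rewrite leq_stop_index jM/=; apply/allP => k.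
rewrite mem_index_iota => /andP[k2 _]; apply/implyP => kj.
by apply: H; rewrite /= k2.
Qed.

Lemma measurable_stop_index_eq m d : measurable [set x | stop_index d x = m].
Proof.
rewrite (_ : [set _ | _] = [set x | (m <= stop_index d x)%N] `\`
  [set x | (m.+1 <= stop_index d x)%N]).
  by apply: measurableD; exact: measurable_leq_stop_index.
apply/seteqP; split => x /=; first by move=> ->; rewrite leqnn ltnn.
by case=> mx /negP; rewrite -leqNgt => xm; apply/eqP; rewrite eqn_leq xm.
Qed.

Lemma measurable_stop_late tau d : measurable (stop_late tau d).
Proof. exact: measurable_leq_stop_index. Qed.

Section Moments.
Context {lambda xi1 xi2 xi3 : R}.
Hypothesis moments : exp_moment_bounds E lambda xi1 xi2 xi3.

Lemma excess_loss_lower_tail (theta : Par E) (t : R) : all_params theta ->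
  (Pstar E [set x | (lambda * excess_loss theta x <=
                     xi1 * excess_risk E theta - t)%R] <= (expR (- t))%:E)%E.
Proof.
move=> Dtheta; have [H _] := moments Dtheta.
have mY : measurable_fun setT (fun x => - lambda * excess_loss theta x).
  by apply/measurable_funM/measurable_excess_loss/all_params_cvx_dom.
rewrite (le_trans _ (chernoff_expectation t mY H))//.
rewrite le_eqVlt; apply/orP; left; apply/eqP; congr (Pstar E _).
by apply/seteqP; split => x /=; lra.
Qed.

Lemma excess_loss_upper_tail (theta : Par E) (t : R) : all_params theta ->
  (Pstar E [set x | (xi3 * excess_risk E theta + t <=
                     lambda * xi2 * excess_loss theta x)%R]
   <= (expR (- t))%:E)%E.
Proof.
move=> Dtheta; have [_ H] := moments Dtheta.
have mY : measurable_fun setT (fun x => lambda * xi2 * excess_loss theta x).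
  by apply/measurable_funM/measurable_excess_loss/all_params_cvx_dom.
exact: (chernoff_expectation t mY H).
Qed.

End Moments.
End Experiment.

(** * Late stopping *)

Section StopLate.
Context {R : realType} {E : experiment R} {lambda xi1 xi2 xi3 tau C8 : R}.
Hypotheses (lambda0 : 0 < lambda) (xi10 : 0 < xi1) (xi20 : 0 < xi2).
Hypothesis moments : exp_moment_bounds E lambda xi1 xi2 xi3.
Variable d : Train E.

(** Downward induction from the near-optimal index. Positivity there propagates to smaller [k], and
    it is what makes [(1 + tau) * cand_risk k.+1 d] at least [cand_risk k.+1 d]. *)
Lemma near_opt_risk_le k : 0 < tau ->
  0 < cand_risk (near_opt_index tau d) d -> (0 < k <= near_opt_index tau d)%N ->
  cand_risk (near_opt_index tau d) d <= cand_risk k d.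
Proof.
move=> tau0 L0 /andP[k0 kK].
have [j Kj] : exists j, near_opt_index tau d = (k + j)%N.
  by exists (near_opt_index tau d - k)%N; rewrite subnKC.
elim: j k k0 kK Kj => [|j IHj] k k0 kK Kj; first by rewrite Kj addn0.
have kK' : (k < near_opt_index tau d)%N by rewrite Kj addnS ltnS leq_addr.
have := IHj k.+1 isT kK'; rewrite addSnnS => /(_ Kj) IH.
have Lk : (1 + tau) * cand_risk k.+1 d < cand_risk k d.
  by apply: lt_near_opt_index; rewrite k0.
apply/ltW/(le_lt_trans _ Lk).
rewrite mulrDl mul1r ler_wpDr// mulr_ge0 ?(ltW tau0)//.
exact: le_trans (ltW L0) IH.
Qed.

Lemma measurable_cand_lower_tail k (c : R) : (0 < k <= nmodels E)%N ->
  measurable [set x | lambda * excess_loss (cand k d) x <= c].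
Proof.
move=> k1; rewrite -[X in measurable X]setTI; apply: measurable_fun_ler => //.
by apply/measurable_funM/measurable_excess_loss/cand_cvx_dom.
Qed.

Lemma measurable_cand_upper_tail k (c : R) : (0 < k <= nmodels E)%N ->
  measurable [set x | c <= lambda * xi2 * excess_loss (cand k d) x].
Proof.
move=> k1; rewrite -[X in measurable X]setTI; apply: measurable_fun_ler => //.
by apply/measurable_funM/measurable_excess_loss/cand_cvx_dom.
Qed.

Lemma measurable_excess_loss_lt i j :
  (0 < i <= nmodels E)%N -> (0 < j <= nmodels E)%N ->
  measurable [set x | excess_loss (cand i d) x < excess_loss (cand j d) x].
Proof.
move=> i1 j1; rewrite -[X in measurable X]setTI.
apply: measurable_fun_ltr => //;
  exact/measurable_excess_loss/cand_cvx_dom.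
Qed.

(* Both tails are cut at [lambda * excess = xi1 * risk / 2]. *)
Lemma cand_misorder_prob i j (c : R) :
  (0 < i <= nmodels E)%N -> (0 < j <= nmodels E)%N ->
  c <= xi1 * cand_risk i d / 2 ->
  c <= xi1 * xi2 * cand_risk i d / 2 - xi3 * cand_risk j d ->
  (Pstar E [set x | (excess_loss (cand i d) x < excess_loss (cand j d) x)%R] <=
   (2 * expR (- c))%:E)%E.
Proof.
move=> i1 j1 c1 c2.
pose A := [set x | lambda * excess_loss (cand i d) x <=
  xi1 * cand_risk i d - xi1 * cand_risk i d / 2].
pose t := xi1 * xi2 * cand_risk i d / 2 - xi3 * cand_risk j d.
pose B := [set x | xi3 * cand_risk j d + t <=
  lambda * xi2 * excess_loss (cand j d) x].
have mA : measurable A by exact: measurable_cand_lower_tail.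
have mB : measurable B by exact: measurable_cand_upper_tail.
apply: (@le_trans _ _ (Pstar E (A `|` B))).
  apply: le_measure; rewrite ?inE; first exact: measurable_excess_loss_lt.
    exact: measurableU.
  move=> x /= ij; rewrite /A/= /B/= /t.
  have [|Ax] := leP (lambda * excess_loss (cand i d) x)
    (xi1 * cand_risk i d - xi1 * cand_risk i d / 2); [by left|right].
  have {}ij : lambda * excess_loss (cand i d) x <
    lambda * excess_loss (cand j d) x by rewrite ltr_pM2l.
  have H : xi1 * cand_risk i d / 2 <= lambda * excess_loss (cand j d) x by lra.
  have : xi2 * (xi1 * cand_risk i d / 2) <=
    xi2 * (lambda * excess_loss (cand j d) x) by rewrite ler_pM2l.
  by lra.
apply: (le_trans (measureU2 _ mA mB)); rewrite mulrDl mul1r EFinD.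
apply: leeD.
  apply: (le_trans (excess_loss_lower_tail moments _ (cand_all_params d i1))).
  by rewrite lee_fin ler_expR lerN2.
apply: (le_trans (excess_loss_upper_tail moments _ (cand_all_params d j1))).
by rewrite lee_fin ler_expR lerN2.
Qed.

(** A nonpositive risk would make the exponential at least 1, and its prefactor is a positive
    integer. *)
Lemma near_opt_risk_gt0 : 0 < C8 -> early_stop_bound tau C8 d < 1 ->
  0 < cand_risk (near_opt_index tau d) d.
Proof.
move=> C80; apply: contraTT; rewrite -!leNgt => L0.
rewrite /early_stop_bound -[leLHS]mulr1; apply: ler_pM => //.
  by rewrite ler1n near_opt_index_gt0.
by rewrite -expR0 ler_expR mulNr oppr_ge0 mulr_ge0_le0// ltW.
Qed.

(** The condition on [tau] bounds [xi3] times the risk of candidate [k + 1] by [xi1 * xi2 / 4] times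
    that of candidate [k], half of the cut level of the upper tail. The remaining quarter, and
    [xi1 / 2] for the lower tail, must dominate [2 * C8]; the 2 is the reserve that absorbs the
    factor of the union bound. *)
Lemma stop_late_prob : 0 < tau -> 0 < C8 -> 4 * xi3 <= xi1 * xi2 * (1 + tau) ->
  2 * C8 <= xi1 / 2 -> 2 * C8 <= xi1 * xi2 / 4 ->
  ((1 - early_stop_bound tau C8 d)%:E <= Pstar E (stop_late tau d))%E.
Proof.
move=> tau0 C80 tauP C8l C8u.
have [b1|b1] := leP 1 (early_stop_bound tau C8 d).
  by apply: (@le_trans _ _ 0%E) => //; rewrite lee_fin subr_le0.
have L0 := near_opt_risk_gt0 C80 b1.
pose K := near_opt_index tau d; pose L := cand_risk K d.
pose e := expR (- C8 * L).
have KM : (K <= nmodels E)%N by exact: near_opt_index_le.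
have K0 : (0 < K)%N by exact: near_opt_index_gt0.
(* Models are numbered from 1, so [i < K.-1] runs over all consecutive pairs of candidates up to
   [K]. *)
pose F i := [set x | excess_loss (cand i.+1 d) x < excess_loss (cand i.+2 d) x].
have mF i : (i < K.-1)%N -> measurable (F i).
  move=> iK; apply: measurable_excess_loss_lt; rewrite /= (leq_trans _ KM)//;
  by rewrite -(prednK K0) ltnS// ltnW.
have PF i : (i < K.-1)%N -> (Pstar E (F i) <= (2 * e ^+ 2)%:E)%E.
  move=> iK; have iK1 : (i.+1 < K)%N by rewrite -(prednK K0) ltnS.
  have -> : e ^+ 2 = expR (- (2 * C8 * L)).
    by rewrite expr2 -expRD; congr expR; ring.
  have Li : L <= cand_risk i.+1 d.
    by apply: near_opt_risk_le => //=; exact: ltnW.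
  have Li1 : (1 + tau) * cand_risk i.+2 d < cand_risk i.+1 d.
    exact: lt_near_opt_index.
  have L0' : 0 < L := L0.
  apply: cand_misorder_prob.
  - by rewrite /= (leq_trans (ltnW iK1)).
  - by rewrite /= (leq_trans iK1).
  - have : 2 * C8 * L <= xi1 / 2 * L by rewrite ler_pM2r.
    have : xi1 / 2 * L <= xi1 / 2 * cand_risk i.+1 d.
      by rewrite ler_pM2l// divr_gt0.
    lra.
  - have : 2 * C8 * L <= xi1 * xi2 / 4 * L by rewrite ler_pM2r.
    have xi0 : 0 < xi1 * xi2 by rewrite mulr_gt0.
    have : xi1 * xi2 / 4 * L <= xi1 * xi2 / 4 * cand_risk i.+1 d.
      by rewrite ler_pM2l// divr_gt0.
    have : 4 * xi3 * cand_risk i.+2 d <=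
        xi1 * xi2 * (1 + tau) * cand_risk i.+2 d.
      rewrite ler_pM2r//; apply: (lt_le_trans L0').
      exact: near_opt_risk_le.
    have : xi1 * xi2 * ((1 + tau) * cand_risk i.+2 d) <=
        xi1 * xi2 * cand_risk i.+1 d by rewrite ler_pM2l// ltW.
    lra.
have mS := measurable_stop_late tau d.
have : (Pstar E (~` stop_late tau d) <= (early_stop_bound tau C8 d)%:E)%E.
  have sub : ~` stop_late tau d `<=` \big[setU/set0]_(i < K.-1) F i.
    (* Stopping strictly before the last model excludes the default value of the minimum, so the
       stopping index is a genuine increase of the loss, at an index between 2 and [K]. *)
    move=> x /= /negP; rewrite -ltnNge leq_min addn1 ltnS => /andP[mK mM].
    have [mE|/andP[]] := bigminn_cases (nmodels E)
        (index_iota 2 (nmodels E).+1)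
        (fun k => cand_loss k.-1 d x < cand_loss k d x).
      by move: mM; rewrite /stop_index mE ltnn.
    rewrite -/(stop_index d x) mem_index_iota cand_loss_lt => /andP[m2 _] mF'.
    move: mK m2 mF'; case: (stop_index d x) => [|[|m]] //= mK _ mF'.
    by rewrite -bigcup_mkord; exists m => //=; rewrite -ltnS (prednK K0).
  have := content_subadditive (Pstar E) mF (measurableC mS) sub.
  move=> /le_trans; apply.
  apply: (@le_trans _ _ (\sum_(i < K.-1) (2 * e ^+ 2)%:E)%E).
    by apply: lee_sum => i _; exact: PF.
  rewrite sumEFin lee_fin big_const_ord iter_addr_0.
  rewrite /early_stop_bound -/K -/L -/e.
  have e0 : 0 < e by exact: expR_gt0.
  (* As [K * e < 1], [K * e] is at least its square; with [r = K - 1], the square exceeds the union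
     bound [2 * r * e ^+ 2] because [(r + 1) ^+ 2 - 2 * r = r ^+ 2 + 1]. *)
  have : K%:R * e < 1 by [].
  rewrite -[_ *+ K.-1]mulr_natl -[in K%:R](prednK K0) -natr1.
  have := ler0n R K.-1.
  move: K.-1%:R => r r0 re.
  have : (r + 1) * ((r + 1) * e) <= (r + 1) * 1 by rewrite ler_pM2l//; lra.
  move=> H; have : ((r + 1) * ((r + 1) * e)) * e <= ((r + 1) * 1) * e.
    by rewrite ler_pM2r.
  rewrite mulr1 => H2; apply: le_trans H2; rewrite -subr_ge0.
  have -> : (r + 1) * ((r + 1) * e) * e - r * (2 * e ^+ 2) =
      (r ^+ 2 + 1) * e ^+ 2.
    by ring.
  by rewrite mulr_ge0 ?addr_ge0 ?sqr_ge0.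
rewrite probability_setC// EFinB -[Pstar _ _]fineK ?fin_num_measure//.
rewrite -!EFinB !lee_fin; lra.
Qed.
End StopLate.

(** * Exponential weights and the oracle inequality *)

(* Uses only [t <= expR t] instead of the entropy of the weights. *)
Lemma exp_weights_mean_le {R : realType} {I : finType} (alpha N : R)
    (y : I -> R) (i0 : I) : 0 < alpha -> #|I|%:R <= N ->
  \sum_i expR (- alpha * y i) * y i <=
  (\sum_i expR (- alpha * y i)) * (y i0 + (ln N + 1) / alpha).
Proof.
move=> alpha0 IN.
have N0 : 0 < N.
  by apply: lt_le_trans IN; rewrite ltr0n; apply/card_gt0P; exists i0.
(* Multiplying the exponential of [alpha * (y i - y i0) - ln N] by the weight of [i] leaves the
   weight of [i0] over [N]. Summed over at most [N] indices this is at most the weight of [i0],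
   hence at most the total weight. *)
have H i : expR (- alpha * y i) * (alpha * (y i - y i0) - ln N) <=
    expR (- alpha * y i0) / N.
  have : alpha * (y i - y i0) - ln N <= expR (alpha * (y i - y i0) - ln N).
    by apply: le_trans (expR_ge1Dx _); rewrite lerDr.
  rewrite -(ler_pM2l (expR_gt0 (- alpha * y i))) => /le_trans; apply.
  rewrite -[X in _ / X](lnK N0) -expRN -!expRD ler_expR le_eqVlt.
  by apply/orP; left; apply/eqP; ring.
have {H} : \sum_i expR (- alpha * y i) * (alpha * (y i - y i0) - ln N) <=
    \sum_i expR (- alpha * y i).
  apply: (@le_trans _ _ (\sum_(i : I) expR (- alpha * y i0) / N)).
    by apply: ler_sum => i _; exact: H.
  rewrite sumr_const -[_ *+ _]mulr_natl.
  apply: (@le_trans _ _ (expR (- alpha * y i0))).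
    rewrite mulrCA ler_piMr ?expR_ge0// ler_pdivrMr// mul1r//.
  by rewrite (bigD1 i0)//= lerDl sumr_ge0// => i _; exact: expR_ge0.
set S := \sum_i expR _; set Y := \sum_i _ * y i.
have -> : \sum_i expR (- alpha * y i) * (alpha * (y i - y i0) - ln N) =
    alpha * Y - S * (alpha * y i0 + ln N).
  rewrite /Y mulr_sumr /S mulr_suml -sumrB; apply: eq_bigr => i _; ring.
move=> H; rewrite -(ler_pM2l alpha0).
have -> : alpha * (S * (y i0 + (ln N + 1) / alpha)) =
    S * (alpha * y i0 + ln N) + S by field; lra.
lra.
Qed.

Lemma bigmin_cases {R : realDomainType} (x0 : R) (r : seq nat) (P : pred nat)
    (F : nat -> R) : let b := \big[Num.min/x0]_(k <- r | P k) F k in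
  b = x0 \/ exists2 k, (k \in r) && P k & b = F k.
Proof.
elim: r => [|k r IHr] /=; first by rewrite big_nil; left.
rewrite big_cons; have {IHr} H : let b := \big[Num.min/x0]_(k <- r | P k) F k in
    b = x0 \/ exists2 j, (j \in k :: r) && P j & b = F j.
  case: IHr => [|[j /andP[jr Pj] bj]]; [by left|right; exists j => //].
  by rewrite in_cons jr orbT.
case: ifP => Pk //; rewrite /Num.min; case: ifP => _ //.
by right; exists k; rewrite // mem_head.
Qed.

Section ESA.
Context {R : realType} {E : experiment R} {alpha : R}.
Hypothesis risk_convex : convex_function (cvx_dom E) (excess_risk E).
Implicit Types (d : Train E) (x : Obs E).

(** The factor due to the loss of the true law is common to all weights and cancels, which leaves
    weights in the excess losses. *)
Lemma esa_barycenter d x : esa alpha d x =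
  barycenter (index_enum 'I_(stop_index d x))
    (fun i => expR (- alpha * excess_loss (cand i.+1 d) x))
    (fun i => cand i.+1 d).
Proof.
have c0 := lt0r_neq0 (expR_gt0 (- alpha * loss (Pstar E) x)).
rewrite -(barycenter_scale _ _ _ c0).
have -> : (fun i : 'I_(stop_index d x) => expR (- alpha * loss (Pstar E) x) *
    expR (- alpha * excess_loss (cand i.+1 d) x)) =
    (fun i => expR (- alpha * cand_loss i.+1 d x)).
  apply/funext => i; rewrite -expRD; congr expR.
  by rewrite /excess_loss /cand_loss; ring.
rewrite /esa /esa_weight /barycenter !big_add1/= !big_mkord scaler_sumr.
by apply: eq_bigr => i _; rewrite scalerA mulrC.
Qed.

(** The number of aggregated candidates is random. Splitting by the value of the stopping index
    leaves barycenters of a fixed finite family. *)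
Lemma measurable_esa_risk d (c : R) :
  measurable [set x | excess_risk E (esa alpha d x) <= c].
Proof.
pose g m x := excess_risk E (barycenter (index_enum 'I_m)
    (fun i => expR (- alpha * excess_loss (cand i.+1 d) x))
    (fun i => cand i.+1 d)).
rewrite (_ : [set _ | _] = \bigcup_(m in [set m | (0 < m <= nmodels E)%N])
   ([set x | stop_index d x = m] `&` [set x | g m x <= c])).
  apply: bigcup_measurable => m /= /andP[m0 mM].
  apply: measurableI; first exact: measurable_stop_index_eq.
  rewrite -[X in measurable X]setTI; apply: measurable_fun_ler => //.
  have cM (i : 'I_m) : (0 < i.+1 <= nmodels E)%N.
    by rewrite /= (leq_trans (ltn_ord i)).
  apply: (measurable_convex_barycenter (@cvx_dom_convex _ E) risk_convex).
  - by rewrite card_ord.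
  - by move=> i x; exact: expR_gt0.
  - move=> i; apply: measurableT_comp => //; apply: measurable_funM => //.
    exact/measurable_excess_loss/cand_cvx_dom.
  - by move=> i; exact: cand_cvx_dom.
apply/seteqP; split => x /=.
  move=> H; exists (stop_index d x).
    by rewrite /= stop_index_gt0 stop_index_le.
  by split => //=; rewrite /g -esa_barycenter.
by case=> m _ [/= <-]; rewrite /g -esa_barycenter.
Qed.

Lemma oracle_riskP tau d : exists2 k,
  [/\ (0 < k)%N, (k <= nmodels E)%N & (k <= near_opt_index tau d + 1)%N] &
  oracle_risk tau d = cand_risk k d.
Proof.
rewrite /oracle_risk.
have [->|[k /andP[+ kK] ->]] := bigmin_cases (cand_risk 1 d)
  (index_iota 1 (nmodels E).+1)
  (fun k => (k <= near_opt_index tau d + 1)%N) (fun k => cand_risk k d).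
  by exists 1%N => //; split; rewrite // ?nmodels_gt0// addn1.
by rewrite mem_index_iota => /andP[k0 kM]; exists k.
Qed.

Section Moments.
Context {lambda xi1 xi2 xi3 tau C8 : R}.
Hypotheses (lambda0 : 0 < lambda) (alpha0 : 0 < alpha).
Hypotheses (xi10 : 0 < xi1) (xi20 : 0 < xi2) (xi30 : 0 < xi3).
Hypothesis moments : exp_moment_bounds E lambda xi1 xi2 xi3.
Hypotheses (tau0 : 0 < tau) (C80 : 0 < C8).

(** The additive error of the aggregate: [u / xi1] from the lower tails, [u / (xi1 * xi2)] from the
    upper tail at the comparison index, and the rest from the exponential weights. *)
Definition tail_slack (u : R) : R :=
  (1 / (xi1 * xi2) + 1 / xi1) * u +
  lambda / (alpha * xi1) * (ln (nmodels E)%:R + 1).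

Lemma esa_risk_le d x j (u : R) : (0 < j <= stop_index d x)%N ->
  (forall k, (0 < k <= nmodels E)%N ->
    xi1 * cand_risk k d - u <= lambda * excess_loss (cand k d) x) ->
  lambda * xi2 * excess_loss (cand j d) x <= xi3 * cand_risk j d + u ->
  excess_risk E (esa alpha d x) <=
  xi3 / (xi1 * xi2) * cand_risk j d + tail_slack u.
Proof.
move=> /andP[j0 jm] lo up; rewrite esa_barycenter.
move: (stop_index_gt0 d x) (stop_index_le d x) jm.
move: (stop_index d x) => m m0 mM jm.
pose w (i : 'I_m) := expR (- alpha * excess_loss (cand i.+1 d) x).
have cM (i : 'I_m) : (0 < i.+1 <= nmodels E)%N.
  by rewrite /= (leq_trans (ltn_ord i)).
have sI : (0 < size (index_enum 'I_m))%N.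
  by move: m0; rewrite -{1}(card_ord m) cardT enumT.
have w0 i : 0 < w i by exact: expR_gt0.
have J := jensen (@cvx_dom_convex _ E) risk_convex sI w0
  (fun i => cand_cvx_dom d (cM i)).
have S0 := sum_gt0 sI w0.
pose y (i : 'I_m) := excess_loss (cand i.+1 d) x.
have jm' : (j.-1 < m)%N by rewrite prednK.
have mM' : #|'I_m|%:R <= (nmodels E)%:R :> R by rewrite card_ord ler_nat.
have := exp_weights_mean_le y (Ordinal jm') alpha0 mM'.
have -> : y (Ordinal jm') = excess_loss (cand j d) x by rewrite /y/= prednK.
move=> G.
rewrite -(ler_pM2l S0); apply: (le_trans J).
apply: (@le_trans _ _ (\sum_i w i * ((lambda * y i + u) / xi1))).
  apply: ler_sum => i _; rewrite ler_pM2l// ler_pdivlMr//.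
  by have := lo i.+1 (cM i); rewrite /y /cand_risk; lra.
have -> : \sum_i w i * ((lambda * y i + u) / xi1) =
    lambda / xi1 * (\sum_i w i * y i) + (\sum_i w i) * (u / xi1).
  by rewrite mulr_sumr mulr_suml -big_split/=; apply: eq_bigr => i _; ring.
set S := \sum_(i <- _) _ in S0 *.
have lx : 0 < lambda / xi1 by rewrite divr_gt0.
move: G; rewrite -(ler_pM2l lx) => G.
apply: (le_trans (lerD G (lexx _))).
rewrite -/S mulrCA -mulrDr ler_pM2l//.
have {}up : excess_loss (cand j d) x <=
    (xi3 * cand_risk j d + u) / (lambda * xi2).
  by rewrite ler_pdivlMr ?mulr_gt0//; lra.
rewrite -(ler_pM2l lx) in up; rewrite mulrDr /tail_slack.
have -> : xi3 / (xi1 * xi2) * cand_risk j d +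
   ((1 / (xi1 * xi2) + 1 / xi1) * u +
    lambda / (alpha * xi1) * (ln (nmodels E)%:R + 1)) =
   lambda / xi1 * ((xi3 * cand_risk j d + u) / (lambda * xi2)) +
   lambda / xi1 * ((ln (nmodels E)%:R + 1) / alpha) + u / xi1.
  by field; rewrite !gt_eqF.
by rewrite lerD2r lerD2r.
Qed.

(** Late stopping puts [j] among the aggregated indices, so [esa_risk_le] applies off [nmodels E]
    lower-tail events and one upper-tail event at [j]; the successor counts the latter. *)
Lemma esa_risk_prob d (u c : R) j :
  [/\ (0 < j)%N, (j <= nmodels E)%N & (j <= near_opt_index tau d + 1)%N] ->
  xi3 / (xi1 * xi2) * cand_risk j d + tail_slack u <= c ->
  (Pstar E (stop_late tau d) <=
   Pstar E [set x | (excess_risk E (esa alpha d x) <= c)%R] +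
   ((nmodels E).+1%:R * expR (- u))%:E)%E.
Proof.
move=> [j0 jM jK] cP.
have j1 : (0 < j <= nmodels E)%N by rewrite j0.
pose T := [set x | excess_risk E (esa alpha d x) <= c].
pose F k := [set x | lambda * excess_loss (cand k.+1 d) x <=
  xi1 * cand_risk k.+1 d - u].
pose B := [set x | xi3 * cand_risk j d + u <=
  lambda * xi2 * excess_loss (cand j d) x].
have mT : measurable T by exact: measurable_esa_risk.
have mF k : (k < nmodels E)%N -> measurable (F k).
  by move=> kM; exact: measurable_cand_lower_tail.
have mB : measurable B by exact: measurable_cand_upper_tail.
have mbF : measurable (\big[setU/set0]_(k < nmodels E) F k).
  by apply: bigsetU_measurable => k _; exact: mF.
have sub : stop_late tau d `<=`
    T `|` (\big[setU/set0]_(k < nmodels E) F k `|` B).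
  move=> x /= xl.
  have [[k /andP[k0 kM] Fk]|nF] := pselect (exists2 k, (0 < k <= nmodels E)%N &
     lambda * excess_loss (cand k d) x < xi1 * cand_risk k d - u).
    right; left; rewrite -bigcup_mkord; exists k.-1; rewrite /= ?prednK//.
    by rewrite /F/= prednK// ltW.
  have [|nB] := leP (xi3 * cand_risk j d + u)
    (lambda * xi2 * excess_loss (cand j d) x); first by right; right.
  left; rewrite /T/=; apply: (le_trans (esa_risk_le _ _ (ltW nB))) => //.
    by rewrite j0 (leq_trans _ xl)// leq_min jK.
  by move=> k k1; rewrite leNgt; apply/negP => Fk; apply: nF; exists k.
apply: (@le_trans _ _
  (Pstar E (T `|` (\big[setU/set0]_(k < nmodels E) F k `|` B)))).
  apply: le_measure => //; apply/mem_set; first exact: measurable_stop_late.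
  exact: measurableU _ _ mT (measurableU _ _ mbF mB).
apply: (le_trans (measureU2 _ mT (measurableU _ _ mbF mB))).
rewrite leeD2l//; apply: (le_trans (measureU2 _ mbF mB)).
rewrite -natr1 mulrDl mul1r EFinD; apply: leeD; last first.
  by apply: (excess_loss_upper_tail moments); exact: cand_all_params.
have := content_subadditive (Pstar E) mF mbF (@subset_refl _ _).
move=> /le_trans; apply.
apply: (@le_trans _ _ (\sum_(i < nmodels E) (expR (- u))%:E)%E).
  apply: lee_sum => i _; apply: (excess_loss_lower_tail moments).
  by apply: cand_all_params; rewrite /=.
by rewrite sumEFin lee_fin sumr_const card_ord mulr_natl.
Qed.

(** Up to the near-optimal index the risks dominate a positive one. The only other admissible index
    is its successor, whose risk is positive by near-optimality. Positivity allows the coefficient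
    of the oracle risk to be enlarged to [C9]. *)
Lemma oracle_risk_gt0 d :
  early_stop_bound tau C8 d < 1 -> 0 < oracle_risk tau d.
Proof.
move=> b1; have L0 := near_opt_risk_gt0 C80 b1.
have [k [k0 kM kK] ->] := oracle_riskP tau d.
have [kK'|Kk] := leqP k (near_opt_index tau d).
  by apply: (lt_le_trans L0); apply: near_opt_risk_le; rewrite ?k0.
have -> : k = (near_opt_index tau d).+1.
  by apply/eqP; rewrite eqn_leq Kk andbT -addn1.
have KM : (near_opt_index tau d < nmodels E)%N by exact: leq_trans kM.
have := lt_le_trans L0 (near_opt_indexP KM).
by rewrite pmulr_rgt0// addr_gt0.
Qed.

Lemma esa_oracle d (n : nat) (C9 : R) : expR 1 <= n%:R :> R ->
  xi3 / (xi1 * xi2) + 2 / (xi1 * xi2) + 2 / xi1 + 2 * lambda / (alpha * xi1)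
    <= C9 ->
  ((1 - early_stop_bound tau C8 d)%:E <= Pstar E (stop_late tau d))%E ->
  ((1 - early_stop_bound tau C8 d - n%:R^-1)%:E <=
   Pstar E [set x | (excess_risk E (esa alpha d x) <=
     C9 * (oracle_risk tau d + ln ((nmodels E)%:R * n%:R)))%R])%E.
Proof.
move=> n1 C9P late.
have n0 : 0 < n%:R :> R := lt_le_trans (expR_gt0 1) n1.
have [b1|b1] := leP 1 (early_stop_bound tau C8 d).
  apply: (@le_trans _ _ 0%E) => //; rewrite lee_fin.
  have : 0 < n%:R^-1 :> R by rewrite invr_gt0. lra.
have O0 := oracle_risk_gt0 b1.
have [j jP Oj] := oracle_riskP tau d.
have M1 : 1 <= (nmodels E)%:R :> R by rewrite ler1n nmodels_gt0.
have M0 : 0 < (nmodels E)%:R :> R by lra.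
pose l : R := ln ((nmodels E)%:R * n%:R).
(* With [1 <= l], both [1 + l] and [ln (nmodels E)%:R + 1] are at most [2 * l]: this is the origin
   of the factors 2 in [C9]. *)
have l1 : 1 <= l.
  rewrite -[leLHS]expRK ler_ln ?posrE ?expR_gt0 ?mulr_gt0//.
  by rewrite (le_trans n1)// ler_peMl// ltW.
have lM : ln (nmodels E)%:R <= l.
  rewrite ler_ln ?posrE ?mulr_gt0// ler_peMr ?ltW//.
  by rewrite (lt_le_trans _ n1)// expR_gt1.
(* The extra 1 pays for the additional event: [expR 1] is at least 2, so
   [(M + 1) * expR (- 1) <= M], and [expR (- l)] turns [M] into the inverse of [n]. *)
pose u : R := 1 + l.
have eu : (nmodels E).+1%:R * expR (- u) <= n%:R^-1.
  rewrite /u opprD expRD mulrA [expR (- l)]expRN lnK ?posrE ?mulr_gt0//.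
  have H : (nmodels E).+1%:R * expR (- 1) <= (nmodels E)%:R :> R.
    rewrite expRN ler_pdivrMr ?expR_gt0// -natr1.
    have : (nmodels E)%:R * (1 + 1) <= (nmodels E)%:R * expR 1 :> R.
      by rewrite ler_pM2l// expR_ge1Dx.
    lra.
  rewrite ler_pdivrMr ?mulr_gt0//; apply: (le_trans H).
  by rewrite mulrCA mulVf ?mulr1// gt_eqF.
have cP : xi3 / (xi1 * xi2) * cand_risk j d + tail_slack u <=
    C9 * (oracle_risk tau d + l).
  have Ol : 0 < oracle_risk tau d + l by lra.
  apply: (@le_trans _ _ ((xi3 / (xi1 * xi2) + 2 / (xi1 * xi2) + 2 / xi1 +
    2 * lambda / (alpha * xi1)) * (oracle_risk tau d + l))); last first.
    by rewrite ler_pM2r//; exact: C9P.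
  rewrite -Oj /tail_slack /u.
  have -> : 2 / (xi1 * xi2) = 2 * (1 / (xi1 * xi2)) by ring.
  have -> : 2 / xi1 = 2 * (1 / xi1) by ring.
  have -> : 2 * lambda / (alpha * xi1) = 2 * (lambda / (alpha * xi1)) by ring.
  have : 0 < xi3 / (xi1 * xi2) by rewrite divr_gt0// mulr_gt0.
  have : 0 < 1 / (xi1 * xi2) by rewrite divr_gt0// mulr_gt0.
  have : 0 < 1 / xi1 by rewrite divr_gt0.
  have : 0 < lambda / (alpha * xi1) by rewrite divr_gt0// mulr_gt0.
  move: (xi3 / _) (1 / (_ * _)) (1 / xi1) (lambda / _) => K A B D D0 B0 A0 K0.
  have : 0 <= K * l by rewrite mulr_ge0; lra.
  have : 0 <= (A + B + D) * oracle_risk tau d by rewrite mulr_ge0; lra.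
  have : 0 <= (A + B) * (l - 1) by rewrite mulr_ge0; lra.
  have : 0 <= D * (l - 1) by rewrite mulr_ge0; lra.
  have : 0 <= D * (l - ln (nmodels E)%:R) by rewrite mulr_ge0; lra.
  lra.
have := le_trans late (esa_risk_prob jP cP).
rewrite -[Pstar E _]fineK ?fin_num_measure//; last exact: measurable_esa_risk.
by rewrite -EFinD !lee_fin; lra.
Qed.

End Moments.
End ESA.

Unset Implicit Arguments.
Set Strict Implicit.

Theorem theoremA2 (R : realType) (lambda alpha : R) (E : nat -> experiment R)
    (lambda_gt0 : 0 < lambda) (alpha_gt0 : 0 < alpha)
    (indep : forall n, independent_samples (E n))
    (moments : exists xi1 xi2 xi3 : R,
      [/\ 0 < xi1, 0 < xi2, 0 < xi3 &
        \forall n \near \oo, exp_moment_bounds (E n) lambda xi1 xi2 xi3]) :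
  (exists tau C8 : R, [/\ 0 < tau, 0 < C8 & stop_late_whp E tau C8]) /\
  ((forall n, convex_function (cvx_dom (E n)) (excess_risk (E n))) ->
   forall tau C8 : R, 0 < tau -> 0 < C8 -> stop_late_whp E tau C8 ->
   exists2 C9 : R, 0 < C9 &
     \forall n \near \oo, {ae train_law (E n), forall d,
       ((1 - early_stop_bound tau C8 d - n%:R^-1)%:E <=
        Pstar (E n) [set x | (excess_risk (E n) (esa alpha d x) <=
          C9 * (oracle_risk tau d + ln ((nmodels (E n))%:R * n%:R)))%R])%E}).
Proof.
have {moments} [xi1 [xi2 [xi3 [xi10 xi20 xi30 moments]]]] := moments.
have xi120 : 0 < xi1 * xi2 by rewrite mulr_gt0.
split.
  (* This [tau] satisfies [4 * xi3 = xi1 * xi2 * tau], and [C8] is the largest constant that both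
     exponent conditions of [stop_late_prob] allow. *)
  exists (4 * xi3 / (xi1 * xi2)), (Num.min (xi1 / 4) (xi1 * xi2 / 8)); split.
  - by rewrite divr_gt0// mulr_gt0.
  - by rewrite lt_min !divr_gt0.
  apply: filterS moments => n mom; apply: aeW => d.
  have C8l : Num.min (xi1 / 4) (xi1 * xi2 / 8) <= xi1 / 4.
    by rewrite ge_min lexx.
  have C8u : Num.min (xi1 / 4) (xi1 * xi2 / 8) <= xi1 * xi2 / 8.
    by rewrite ge_min lexx orbT.
  apply: (stop_late_prob lambda_gt0 xi10 xi20 mom).
  - by rewrite divr_gt0// mulr_gt0.
  - by rewrite lt_min !divr_gt0.
  - by rewrite mulrDr mulr1 [X in _ + X]mulrC divfK ?gt_eqF// lerDr ltW.
  - lra.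
  - lra.
move=> risk_convex tau C8 tau0 C80 late.
exists (xi3 / (xi1 * xi2) + 2 / (xi1 * xi2) + 2 / xi1 +
  2 * lambda / (alpha * xi1)).
  by rewrite !addr_gt0 ?divr_gt0 ?mulr_gt0.
have large : \forall n \near \oo, expR 1 <= n%:R :> R.
  exact: nbhs_infty_ger.
near=> n.
have mom : exp_moment_bounds (E n) lambda xi1 xi2 xi3 by near: n.
have n1 : expR 1 <= n%:R :> R by near: n.
have : {ae train_law (E n), forall d,
    ((1 - early_stop_bound tau C8 d)%:E <= Pstar (E n) (stop_late tau d))%E}.
  by near: n.
apply: filterS => d Hd.
exact: (esa_oracle (risk_convex n) lambda_gt0 alpha_gt0 xi10 xi20 xi30 mom
  tau0 C80 n1 (lexx _) Hd).
Unshelve. all: by end_near.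
Qed.
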